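(* Let $H=K\,\triangleright\!\!\!\blacktriangleleft L$ be a Hopf algebra with the structure of a (right–left) bicrossproduct of Hopf algebras $K$ and $L$, let $\langle\cdot,\cdot\rangle_1$ and $\langle\cdot,\cdot\rangle_2$ be nondegenerate Hopf algebra pairings for $(K,K^* )$ and $(L,L^* )$, let $H^*=K^*\blacktriangleright\!\!\!\triangleleft\, L^*$ be the dual bicrossproduct, and equip $(H,H^* )$ with the pairing $\langle kl,\kappa\lambda\rangle=\langle k,\kappa\rangle_1\langle l,\lambda\rangle_2$. If $(k_m)$ and $(\kappa^m)$ are dual bases for $K$ and $K^*$, and $(l_n)$ and $(\lambda^n)$ are dual bases for $L$ and $L^*$, then $(k_ml_n)$ and $(\kappa^m\lambda^n)$ are dual bases for $H$ and $H^*$. In other words, if $\langle k_m,\kappa^{m'}\rangle_1=\delta_m^{m'}$ and $\langle l_n,\lambda^{n'}\rangle_2=\delta_n^{n'}$, then $\langle k_ml_n,\kappa^{m'}\lambda^{n'}\rangle=\delta_m^{m'}\delta_n^{n'}$.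
   Context: The base field $\mathbb{K}$ is $\mathbb{R}$ or $\mathbb{C}$. Sweedler notation $\Delta(c)=c_{(1)}\otimes c_{(2)}$ is used. Dual bases: bases $(h^m)$ of $H$ and $(h'_n)$ of $H'$ (indexed by the same set) are dual with respect to a nondegenerate pairing if $\langle h^m,h'_n\rangle=c_n\delta^m_n$ with $c_n\in\mathbb{K}\setminus\{0\}$. Pairing: a pairing between Hopf algebras $H$ and $H'$ is a bilinear map $\langle\cdot,\cdot\rangle:H\times H'\to\mathbb{K}$ with $\langle h,h'k'\rangle=\langle\Delta(h),h'\otimes k'\rangle$, $\langle h,1_{H'}\rangle=\epsilon(h)$, $\langle h\otimes k,\Delta'(h')\rangle=\langle hk,h'\rangle$, $\epsilon'(h')=\langle 1_H,h'\rangle$, $\langle h,S'(h')\rangle=\langle S(h),h'\rangle$. It is nondegenerate if $\langle h,\cdot\rangle=0$ implies $h=0$ and $\langle\cdot,h'\rangle=0$ implies $h'=0$. Right–left bicrossproduct: $L$ is a right $K$-module algebra (action $l\triangleleft k$) and $K$ is a left $L$-comodule coalgebra (coaction $k\mapsto k\blacktriangleleft\,=k^{(1)}\otimes k^{(2)}\in L\otimes K$) satisfying $\epsilon(l\triangleleft k)=\epsilon(l)\epsilon(k)$; $\Delta(l\triangleleft k)=(l_{(1)}\triangleleft k_{(1)}){k_{(2)}}^{(1)}\otimes l_{(2)}\triangleleft{k_{(2)}}^{(2)}$; $1\blacktriangleleft\,=1\otimes1$; $(kk')\blacktriangleleft\,=(k^{(1)}\triangleleft k'_{(1)}){k'_{(2)}}^{(1)}\otimes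 k^{(2)}{k'_{(2)}}^{(2)}$; ${k_{(1)}}^{(1)}(l\triangleleft k_{(2)})\otimes{k_{(1)}}^{(2)}=(l\triangleleft k_{(1)}){k_{(2)}}^{(1)}\otimes{k_{(2)}}^{(2)}$. $H=K\triangleright\!\!\!\blacktriangleleft L$ is the vector space $K\otimes L$ (write $kl=k\otimes l$) with product $(k\otimes l)(k'\otimes l')=kk'_{(1)}\otimes(l\triangleleft k'_{(2)})l'$ and coproduct $\Delta(k\otimes l)=k_{(1)}\otimes{k_{(2)}}^{(1)}l_{(1)}\otimes{k_{(2)}}^{(2)}\otimes l_{(2)}$. Dual: $K^*$, $L^*$ denote Hopf algebras in nondegenerate duality with $K$, $L$. $H^*=K^*\blacktriangleright\!\!\!\triangleleft L^*$ is the vector space $K^*\otimes L^*$ (write $\kappa\lambda=\kappa\otimes\lambda$), with product $(\kappa\lambda)(\kappa'\lambda')=\kappa(\lambda_{(1)}\triangleright\kappa')\lambda_{(2)}\lambda'$ and coproduct $\Delta(\kappa\lambda)=\kappa_{(1)}{\lambda_{(1)}}^{(1)}\otimes\kappa_{(2)}{\lambda_{(1)}}^{(2)}\lambda_{(2)}$, where the left action of $L^*$ on $K^*$ and the right coaction $\lambda\mapsto\lambda^{(1)}\otimes\lambda^{(2)}\in L^*\otimes K^*$ are dual to those of $H$: $\langle k,\lambda\triangleright\kappa\rangle_1=\langle k^{(1)},\lambda\rangle_2\langle k^{(2)},\kappa\rangle_1$, $\langle l\triangleleft k,\lambda\rangle_2=\langle l,\lambda^{(1)}\rangle_2\langle k,\lambda^{(2)}\rangle_1$.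 *)

(* Defs.v *)
From HB Require Import structures.
From mathcomp Require Import all_boot all_order all_algebra generic_quotient.
From mathcomp Require Import boolp reals complex.

Set Implicit Arguments.
Unset Strict Implicit.
Unset Printing Implicit Defensive.

Import GRing.Theory.
Local Open Scope ring_scope.
Local Open Scope quotient_scope.

Variant ground_field := RealNumbers | ComplexNumbers.

Definition base_field (R : realType) (f : ground_field) : fieldType :=
  match f with RealNumbers => R | ComplexNumbers => R[i] end.

Reserved Notation "V ⊗ W" (at level 48, left associativity).
Reserved Notation "'\sw_' ( a , b <- x ) E"
  (at level 49, a name, b name, x at level 41, E at level 49,
   format "'\sw_' ( a ,  b  <-  x )  E").

Section TensorProduct.
Variables (F : fieldType) (V W : lmodType F).

Definition formal_sum (U : nmodType) (f : V -> W -> U) (s : seq (V * W)) : U :=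
  \sum_(p <- s) f p.1 p.2.

(* A tensor is a formal sum of pairs; two formal sums are the same tensor when *)
(* no bilinear map separates them. [tensor_lift] below is the universal        *)
(* property this quotient is built to have.                                    *)
Definition tensor_eqv (s t : seq (V * W)) : bool :=
  `[< forall (U : lmodType F) (f : {bilinear V -> W -> U}),
        formal_sum f s = formal_sum f t >].

Lemma tensor_eqv_refl : reflexive tensor_eqv.
Proof. by move=> s; apply/asboolP. Qed.

Lemma tensor_eqv_sym : symmetric tensor_eqv.
Proof.
by move=> s t; apply/asboolP/asboolP => st U f; rewrite st.
Qed.

Lemma tensor_eqv_trans : transitive tensor_eqv.
Proof.
move=> t s u /asboolP st /asboolP tu; apply/asboolP => U f.
by rewrite st tu.
Qed.

Canonical tensor_equiv_rel :=
  EquivRel tensor_eqv tensor_eqv_refl tensor_eqv_sym tensor_eqv_trans.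

Definition tensor := {eq_quot tensor_eqv}.

HB.instance Definition _ := Choice.on tensor.
HB.instance Definition _ := EqQuotient.on tensor.

Implicit Types (x y z : tensor).

(* Sweedler summation: if [x] is the class of the formal sum of (a_i, b_i),   *)
(* this is the sum of the f a_i b_i. It only makes sense, and is only used,   *)
(* for a bilinear [f], in which case it does not depend on the representative *)
(* (see [tensor_sum_pi]).                                                     *)
Definition tensor_sum (U : nmodType) (x : tensor) (f : V -> W -> U) : U :=
  formal_sum f (repr x).

Lemma formal_sum_cat (U : nmodType) (f : V -> W -> U) s t :
  formal_sum f (s ++ t) = formal_sum f s + formal_sum f t.
Proof. by rewrite /formal_sum big_cat. Qed.

Definition scale_fst (a : F) (s : seq (V * W)) := [seq (a *: p.1, p.2) | p <- s].

Lemma formal_sum_scale (U : lmodType F) (f : {bilinear V -> W -> U}) a s :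
  formal_sum f (scale_fst a s) = a *: formal_sum f s.
Proof.
rewrite /formal_sum big_map scaler_sumr; apply: eq_bigr => p _.
by rewrite /= linearZl_LR.
Qed.

Lemma tensor_sum_pi (U : lmodType F) (f : {bilinear V -> W -> U}) s :
  tensor_sum (\pi_tensor s) f = formal_sum f s.
Proof.
have /eqmodP/asboolP : repr (\pi_tensor s) = s %[mod tensor] by rewrite reprK.
exact.
Qed.

Lemma tensor_ext x y :
  (forall (U : lmodType F) (f : {bilinear V -> W -> U}),
     tensor_sum x f = tensor_sum y f) -> x = y.
Proof.
by move=> xy; rewrite -[x]reprK -[y]reprK; apply/eqmodP/asboolP.
Qed.

Definition tensor_zero : tensor := \pi_tensor [::].
Definition tensor_add x y : tensor := \pi_tensor (repr x ++ repr y).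
Definition tensor_scale a x : tensor := \pi_tensor (scale_fst a (repr x)).
Definition tensor_opp x : tensor := tensor_scale (-1) x.

Lemma tensor_sum_zero (U : lmodType F) (f : {bilinear V -> W -> U}) :
  tensor_sum tensor_zero f = 0.
Proof. by rewrite tensor_sum_pi /formal_sum big_nil. Qed.

Lemma tensor_sum_add (U : lmodType F) (f : {bilinear V -> W -> U}) x y :
  tensor_sum (tensor_add x y) f = tensor_sum x f + tensor_sum y f.
Proof. by rewrite tensor_sum_pi formal_sum_cat. Qed.

Lemma tensor_sum_scale (U : lmodType F) (f : {bilinear V -> W -> U}) a x :
  tensor_sum (tensor_scale a x) f = a *: tensor_sum x f.
Proof. by rewrite tensor_sum_pi formal_sum_scale. Qed.

Fact tensor_addA : associative tensor_add.
Proof. by move=> x y z; apply: tensor_ext => U f; rewrite !tensor_sum_add addrA. Qed.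

Fact tensor_addC : commutative tensor_add.
Proof. by move=> x y; apply: tensor_ext => U f; rewrite !tensor_sum_add addrC. Qed.

Fact tensor_add0 : left_id tensor_zero tensor_add.
Proof.
by move=> x; apply: tensor_ext => U f; rewrite tensor_sum_add tensor_sum_zero add0r.
Qed.

Fact tensor_addN : left_inverse tensor_zero tensor_opp tensor_add.
Proof.
move=> x; apply: tensor_ext => U f.
by rewrite tensor_sum_add tensor_sum_scale tensor_sum_zero scaleN1r addNr.
Qed.

HB.instance Definition _ :=
  GRing.isZmodule.Build tensor tensor_addA tensor_addC tensor_add0 tensor_addN.

Lemma tensor_sumD (U : lmodType F) (f : {bilinear V -> W -> U}) x y :
  tensor_sum (x + y) f = tensor_sum x f + tensor_sum y f.
Proof. exact: tensor_sum_add. Qed.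

Fact tensor_scaleA a b x :
  tensor_scale a (tensor_scale b x) = tensor_scale (a * b) x.
Proof. by apply: tensor_ext => U f; rewrite !tensor_sum_scale scalerA. Qed.

Fact tensor_scale1 : left_id 1 tensor_scale.
Proof. by move=> x; apply: tensor_ext => U f; rewrite tensor_sum_scale scale1r. Qed.

Fact tensor_scaleDr : right_distributive tensor_scale +%R.
Proof.
move=> a x y; apply: tensor_ext => U f.
by rewrite !(tensor_sum_scale, tensor_sumD) scalerDr.
Qed.

Fact tensor_scaleDl x :
  {morph tensor_scale^~ x : a b / a + b}.
Proof.
move=> a b; apply: tensor_ext => U f.
by rewrite !(tensor_sum_scale, tensor_sumD) scalerDl.
Qed.

HB.instance Definition _ :=
  GRing.Zmodule_isLmodule.Build F tensor
    tensor_scaleA tensor_scale1 tensor_scaleDr tensor_scaleDl.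

Lemma tensor_sumZ (U : lmodType F) (f : {bilinear V -> W -> U}) a x :
  tensor_sum (a *: x) f = a *: tensor_sum x f.
Proof. exact: tensor_sum_scale. Qed.

Definition tens (v : V) (w : W) : tensor := \pi_tensor [:: (v, w)].

Lemma tensor_sum_tens (U : lmodType F) (f : {bilinear V -> W -> U}) v w :
  tensor_sum (tens v w) f = f v w.
Proof. by rewrite tensor_sum_pi /formal_sum big_seq1. Qed.

Fact tens_is_bilinear : bilinear_for *:%R *:%R tens.
Proof.
split=> [w a v v'|v a w w']; apply: tensor_ext => U f.
  by rewrite tensor_sumD tensor_sumZ !tensor_sum_tens linearPl.
by rewrite tensor_sumD tensor_sumZ !tensor_sum_tens linearPr.
Qed.

HB.instance Definition _ :=
  bilinear_isBilinear.Build F V W tensor *:%R *:%R tens tens_is_bilinear.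

Lemma tensorE x : x = tensor_sum x tens.
Proof.
rewrite -{1}[x]reprK /tensor_sum; elim: (repr x) => [|[v w] s IH].
  by rewrite /formal_sum big_nil.
rewrite /formal_sum big_cons -/(formal_sum _ _) -IH /=.
apply: tensor_ext => U f.
by rewrite tensor_sumD !tensor_sum_pi -formal_sum_cat.
Qed.

Lemma tensor_lift (U : lmodType F) (f : {bilinear V -> W -> U}) :
  exists g : {linear tensor -> U},
    (forall v w, g (tens v w) = f v w) /\
    (forall g' : {linear tensor -> U},
       (forall v w, g' (tens v w) = f v w) -> g' =1 g).
Proof.
pose g x := tensor_sum x f.
have gL : linear g by move=> a x y; rewrite /g tensor_sumD tensor_sumZ.
pose gLM := GRing.isLinear.Build F tensor U *:%R g gL.
pose G : {linear tensor -> U} := HB.pack g gLM.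
exists G; split=> [v w|g' g'E x]; first exact: tensor_sum_tens.
rewrite [in LHS](tensorE x) /tensor_sum /formal_sum linear_sum /=.
by rewrite /g /tensor_sum; apply: eq_bigr => p _; exact: g'E.
Qed.

End TensorProduct.

Notation "V ⊗ W" := (tensor V W) : type_scope.
Notation "v ⊗ w" := (tens v w) : ring_scope.
Notation "'\sw_' ( a , b <- x ) E" := (tensor_sum x (fun a b => E)) : ring_scope.

HB.mixin Record isCoalgebra (F : fieldType) C of GRing.Lmodule F C := {
  comul : {linear C -> (C ⊗ C)%type};
  counit : {scalar C};
  comulA : forall c,
    \sw_(a, b <- comul c) \sw_(a1, a2 <- comul a) a1 ⊗ (a2 ⊗ b)
    = \sw_(a, b <- comul c) a ⊗ comul b;
  counitl : forall c, \sw_(a, b <- comul c) counit a *: b = c;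
  counitr : forall c, \sw_(a, b <- comul c) counit b *: a = c
}.

#[short(type="coalgType")]
HB.structure Definition Coalgebra (F : fieldType) :=
  {C of GRing.Lmodule F C & isCoalgebra F C}.

HB.mixin Record isHopf (F : fieldType) H
    of GRing.Algebra F H & isCoalgebra F H := {
  comul1 : comul (1 : H) = 1 ⊗ 1;
  comulM : forall g h : H,
    comul (g * h) =
      \sw_(g1, g2 <- comul g) \sw_(h1, h2 <- comul h) (g1 * h1) ⊗ (g2 * h2);
  counit1 : counit (1 : H) = 1;
  counitM : forall g h : H, counit (g * h) = counit g * counit h;
  antipode : {linear H -> H};
  antipodel : forall h : H,
    \sw_(h1, h2 <- comul h) antipode h1 * h2 = (counit h)%:A;
  antipoder : forall h : H,
    \sw_(h1, h2 <- comul h) h1 * antipode h2 = (counit h)%:A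
}.

#[short(type="hopfAlgType")]
HB.structure Definition HopfAlgebra (F : fieldType) :=
  {H of GRing.Algebra F H & isCoalgebra F H & isHopf F H}.

Section ActionsCoactions.
Variable F : fieldType.

Record right_module_algebra (K L : hopfAlgType F)
    (act : {bilinear L -> K -> L}) : Prop := RightModuleAlgebra {
  ract1 : forall l, act l 1 = l;
  ractM : forall l k k', act l (k * k') = act (act l k) k';
  mul_ract : forall l l' k,
    act (l * l') k = \sw_(k1, k2 <- comul k) act l k1 * act l' k2;
  one_ract : forall k, act 1 k = (counit k)%:A
}.

Record left_comodule_coalgebra (K L : hopfAlgType F)
    (coact : {linear K -> (L ⊗ K)%type}) : Prop := LeftComoduleCoalgebra {
  lcoactA : forall k,
    \sw_(l, k' <- coact k) \sw_(l1, l2 <- comul l) l1 ⊗ (l2 ⊗ k')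
    = \sw_(l, k' <- coact k) l ⊗ coact k';
  lcoact_counit : forall k, \sw_(l, k' <- coact k) counit l *: k' = k;
  lcoact_comul : forall k,
    \sw_(l, k' <- coact k) l ⊗ comul k'
    = \sw_(k1, k2 <- comul k) \sw_(x1, y1 <- coact k1) \sw_(x2, y2 <- coact k2)
        (x1 * x2) ⊗ (y1 ⊗ y2);
  lcoact_eps : forall k,
    \sw_(l, k' <- coact k) counit k' *: l = (counit k)%:A
}.

Record left_action (A : hopfAlgType F) (V : lmodType F)
    (act : {bilinear A -> V -> V}) : Prop := LeftAction {
  lact1 : forall v, act 1 v = v;
  lactM : forall a b v, act (a * b) v = act a (act b v)
}.

Record right_coaction (C : hopfAlgType F) (V : lmodType F)
    (coact : {linear V -> (V ⊗ C)%type}) : Prop := RightCoaction {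
  rcoactA : forall v,
    \sw_(w, c <- coact v) \sw_(w', c' <- coact w) w' ⊗ (c' ⊗ c)
    = \sw_(w, c <- coact v) w ⊗ comul c;
  rcoact_counit : forall v, \sw_(w, c <- coact v) counit c *: w = v
}.

Record bicross_compatible (K L : hopfAlgType F)
    (act : {bilinear L -> K -> L}) (coact : {linear K -> (L ⊗ K)%type}) : Prop :=
  BicrossCompatible {
  bicross_modalg : right_module_algebra act;
  bicross_comodcoalg : left_comodule_coalgebra coact;
  counit_ract : forall l k, counit (act l k) = counit l * counit k;
  comul_ract : forall l k,
    comul (act l k) =
      \sw_(l1, l2 <- comul l) \sw_(k1, k2 <- comul k) \sw_(x, y <- coact k2)
        (act l1 k1 * x) ⊗ act l2 y;
  lcoact1 : coact 1 = 1 ⊗ 1;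
  lcoactM : forall k k',
    coact (k * k') =
      \sw_(x, y <- coact k) \sw_(k1, k2 <- comul k') \sw_(x', y' <- coact k2)
        (act x k1 * x') ⊗ (y * y');
  ract_lcoact : forall l k,
    \sw_(k1, k2 <- comul k) \sw_(x, y <- coact k1) (x * act l k2) ⊗ y
    = \sw_(k1, k2 <- comul k) \sw_(x, y <- coact k2) (act l k1 * x) ⊗ y
}.

(* The Hopf algebra [H] is the bicrossproduct of [K] and [L]: its underlying *)
(* vector space is identified with K ⊗ L through [phi], so that the element  *)
(* written kl on paper is phi (k ⊗ l). For a Hopf algebra carried by K ⊗ L   *)
(* itself, [phi] is the identity.                                            *)
Record is_bicrossproduct (K L H : hopfAlgType F)
    (act : {bilinear L -> K -> L}) (coact : {linear K -> (L ⊗ K)%type})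
    (phi : {linear (K ⊗ L)%type -> H}) : Prop := IsBicrossproduct {
  bicross_compat : bicross_compatible act coact;
  bicross_bij : bijective phi;
  bicross_mul : forall k l k' l',
    phi (k ⊗ l) * phi (k' ⊗ l')
    = \sw_(k1, k2 <- comul k') phi ((k * k1) ⊗ (act l k2 * l'));
  bicross_comul : forall k l,
    comul (phi (k ⊗ l)) =
      \sw_(k1, k2 <- comul k) \sw_(x, y <- coact k2) \sw_(l1, l2 <- comul l)
        phi (k1 ⊗ (x * l1)) ⊗ phi (y ⊗ l2)
}.

Record hopf_pairing (H H' : hopfAlgType F)
    (B : {bilinear H -> H' -> F | *%R & *%R}) : Prop := HopfPairing {
  pairing_mulr : forall h h' k',
    B h (h' * k') = \sw_(h1, h2 <- comul h) B h1 h' * B h2 k';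
  pairing_1r : forall h, B h 1 = counit h;
  pairing_mull : forall h k h',
    \sw_(h1, h2 <- comul h') B h h1 * B k h2 = B (h * k) h';
  pairing_1l : forall h', counit h' = B 1 h';
  pairing_antipode : forall h h', B h (antipode h') = B (antipode h) h'
}.

Record nondegenerate_pairing (H H' : hopfAlgType F)
    (B : {bilinear H -> H' -> F | *%R & *%R}) : Prop := NondegeneratePairing {
  nondeg_pairing : hopf_pairing B;
  nondegl : forall h, (forall h', B h h' = 0) -> h = 0;
  nondegr : forall h', (forall h, B h h' = 0) -> h' = 0
}.

Definition is_basis (I : eqType) (V : lmodType F) (b : I -> V) : Prop :=
  (forall (s : seq I) (a : I -> F), uniq s ->
     \sum_(i <- s) a i *: b i = 0 -> {in s, forall i, a i = 0}) /\
  (forall v, exists (s : seq I) (a : I -> F), v = \sum_(i <- s) a i *: b i).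

Record dual_bases (H H' : hopfAlgType F)
    (B : {bilinear H -> H' -> F | *%R & *%R}) (I : eqType)
    (b : I -> H) (b' : I -> H') : Prop := DualBases {
  dual_nondeg : nondegenerate_pairing B;
  dual_basisl : is_basis b;
  dual_basisr : is_basis b';
  dual_orth : exists c : I -> F,
    (forall n, c n != 0) /\ (forall m n, B (b m) (b' n) = c n * (m == n)%:R)
}.

(* The Hopf algebra [Hs] = Ks ▶◁ Ls is the bicrossproduct dual to the        *)
(* bicrossproduct of [K] and [L] given by [act] and [coact], where Ks and Ls *)
(* are in duality with K and L through [B1] and [B2]; the element written κλ *)
(* on paper is psi (κ ⊗ λ).                                                  *)
Record is_dual_bicrossproduct (K L Ks Ls Hs : hopfAlgType F)
    (B1 : {bilinear K -> Ks -> F | *%R & *%R})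
    (B2 : {bilinear L -> Ls -> F | *%R & *%R})
    (act : {bilinear L -> K -> L}) (coact : {linear K -> (L ⊗ K)%type})
    (lact : {bilinear Ls -> Ks -> Ks}) (rcoact : {linear Ls -> (Ls ⊗ Ks)%type})
    (psi : {linear (Ks ⊗ Ls)%type -> Hs}) : Prop := IsDualBicrossproduct {
  dual_left_action : left_action lact;
  dual_right_coaction : right_coaction rcoact;
  dual_actE : forall k la ka,
    B1 k (lact la ka) = \sw_(x, y <- coact k) B2 x la * B1 y ka;
  dual_coactE : forall l k la,
    B2 (act l k) la = \sw_(x, y <- rcoact la) B2 l x * B1 k y;
  dual_bij : bijective psi;
  dual_mul : forall ka la ka' la',
    psi (ka ⊗ la) * psi (ka' ⊗ la')
    = \sw_(la1, la2 <- comul la) psi ((ka * lact la1 ka') ⊗ (la2 * la'));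
  dual_comul : forall ka la,
    comul (psi (ka ⊗ la)) =
      \sw_(ka1, ka2 <- comul ka) \sw_(la1, la2 <- comul la)
      \sw_(x, y <- rcoact la1)
        psi (ka1 ⊗ x) ⊗ psi ((ka2 * y) ⊗ la2)
}.

End ActionsCoactions.

(* Main.v *)
(* On pure tensors the pairing of [H] with [Hs] turns the product of one       *)
(* bicrossproduct into the coproduct of the other, since action and coaction   *)
(* are mutually dual. It is nondegenerate because the candidate bases are      *)
(* spanning and biorthogonal. The remaining Hopf pairing axioms are then       *)
(* automatic: nondegeneracy makes pairing with 1 a counit, and the antipode    *)
(* axiom is uniqueness of convolution inverses, so neither the unit, counit    *)
(* nor antipode of the bicrossproducts has to be computed.                     *)
From HB Require Import structures.
Require Import Defs.
From mathcomp Require Import all_boot all_algebra reals.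
From mathcomp Require Import ring.

Set Implicit Arguments.
Unset Strict Implicit.
Unset Printing Implicit Defensive.

Import GRing.Theory.

Local Open Scope ring_scope.

(** Orthogonality of the product families is read off the product form of the pairing; the substance
    is that [B] is a nondegenerate Hopf pairing and that both families are bases. On pure tensors,
    each product-coproduct axiom for [B] expands on both sides into the same sum of values of [B1]
    and [B2]: the axioms of [B1] and [B2] split products, and action and coaction are traded for
    their duals ([bicross_pairing_mulr], [bicross_pairing_mull]). The product families span, and
    pairing with one family reads off coefficients along the other up to nonzero scalars; this
    yields independence and nondegeneracy together ([biorthogonal_basis]).
    [nondegenerate_pairing_of_mul] then supplies the unit and antipode axioms. *)

Lemma raddf_tensor_sum (F : fieldType) (V W : lmodType F) (U U' : nmodType)
    (g : {additive U -> U'}) (x : (V ⊗ W)%type) (f : V -> W -> U) :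
  g (tensor_sum x f) = \sw_(a, b <- x) g (f a b).
Proof. exact: raddf_sum. Qed.

Lemma eq_tensor_sum (F : fieldType) (V W : lmodType F) (U : nmodType)
    (f g : V -> W -> U) (x : (V ⊗ W)%type) :
  (forall a b, f a b = g a b) -> tensor_sum x f = tensor_sum x g.
Proof. by move=> fg; apply: eq_bigr. Qed.

Lemma exchange_tensor_sum (F : fieldType) (V W V' W' : lmodType F) (U : nmodType)
    (x : (V ⊗ W)%type) (y : (V' ⊗ W')%type) (f : V -> W -> V' -> W' -> U) :
  \sw_(a, b <- x) \sw_(c, d <- y) f a b c d
  = \sw_(c, d <- y) \sw_(a, b <- x) f a b c d.
Proof. exact: exchange_big. Qed.

Lemma exchange_tensor_sum2 (F : fieldType) (V0 V1 V2 V3 V4 V5 V6 V7 : lmodType F)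
    (U : nmodType) (x : (V0 ⊗ V1)%type) (x' : V0 -> V1 -> (V2 ⊗ V3)%type)
    (y : (V4 ⊗ V5)%type) (y' : V4 -> V5 -> (V6 ⊗ V7)%type)
    (f : V0 -> V1 -> V2 -> V3 -> V4 -> V5 -> V6 -> V7 -> U) :
  \sw_(a, b <- x) \sw_(a', b' <- x' a b)
    \sw_(c, d <- y) \sw_(c', d' <- y' c d) f a b a' b' c d c' d'
  = \sw_(c, d <- y) \sw_(c', d' <- y' c d)
      \sw_(a, b <- x) \sw_(a', b' <- x' a b) f a b a' b' c d c' d'.
Proof.
under eq_tensor_sum do rewrite exchange_tensor_sum.
rewrite exchange_tensor_sum; apply: eq_tensor_sum => c d.
under eq_tensor_sum do rewrite exchange_tensor_sum.
by rewrite exchange_tensor_sum.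
Qed.

Lemma tensor_sum_const0 (F : fieldType) (V W : lmodType F) (U : nmodType)
    (x : (V ⊗ W)%type) : tensor_sum x (fun _ _ => 0 : U) = 0.
Proof. exact: big1. Qed.

Lemma tensor_sum_split (F : fieldType) (V W : lmodType F) (U : nmodType)
    (f g : V -> W -> U) (x : (V ⊗ W)%type) :
  \sw_(a, b <- x) (f a b + g a b) = tensor_sum x f + tensor_sum x g.
Proof. exact: big_split. Qed.

Lemma mulr_tensor_suml (F : fieldType) (V W : lmodType F)
    (x : (V ⊗ W)%type) (f : V -> W -> F) c :
  tensor_sum x f * c = \sw_(a, b <- x) (f a b * c).
Proof. exact: mulr_suml. Qed.

Lemma mulr_tensor_sumr (F : fieldType) (V W : lmodType F)
    (x : (V ⊗ W)%type) (f : V -> W -> F) c :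
  c * tensor_sum x f = \sw_(a, b <- x) (c * f a b).
Proof. exact: mulr_sumr. Qed.

(** * Induction on tensors, and coalgebra axioms tested on linear forms *)

Lemma tensor_ind (F : fieldType) (V W : lmodType F) (P : (V ⊗ W)%type -> Prop) :
  P 0 -> (forall x y, P x -> P y -> P (x + y)) -> (forall v w, P (v ⊗ w)) ->
  forall x, P x.
Proof.
by move=> P0 PD Pt x; rewrite [x]tensorE; apply: (big_ind P) => // p _.
Qed.

(** [tensor_sum] is computed on a chosen representative, so a Sweedler sum of products of scalars is
    handled through the linear form u ⊗ v: the first property folds the sum into it, the second
    evaluates it on pure tensors. *)
Lemma tensor_form (F : fieldType) (V W : lmodType F)
    (u : {scalar V}) (v : {scalar W}) :
  exists2 g : {scalar (V ⊗ W)%type},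
    forall x, g x = \sw_(a, b <- x) (u a * v b)
    & forall a b, g (a ⊗ b) = u a * v b.
Proof.
(* [F^o] is the field as a vector space over itself, the target demanded by the universal
   property. *)
pose f (a : V) (b : W) : F^o := u a * v b.
have fB : bilinear_for *:%R *:%R f.
  split=> [w a x y|x a w w']; rewrite /f linearP.
    by rewrite mulrDl -mulrA.
  by rewrite mulrDr mulrCA.
pose fM := bilinear_isBilinear.Build F V W F^o *:%R *:%R f fB.
pose fP : {bilinear V -> W -> F^o} := HB.pack f fM.
pose g (x : (V ⊗ W)%type) : F := tensor_sum x fP.
have gL : scalar g.
  by move=> a x y; rewrite /g tensor_sumD tensor_sumZ.
pose gM := GRing.isLinear.Build F (V ⊗ W)%type F *%R g gL.
exists (HB.pack g gM : {scalar (V ⊗ W)%type}) => // a b.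
exact: (tensor_sum_tens fP).
Qed.

(** The form u ⊗ (v ⊗ w) is applied to coassociativity. *)
Lemma comulA_form (F : fieldType) (C : coalgType F) (u v w : {scalar C}) (c : C) :
  \sw_(a, b <- comul c) \sw_(a1, a2 <- comul a) (u a1 * (v a2 * w b))
  = \sw_(a, b <- comul c) \sw_(b1, b2 <- comul b) (u a * (v b1 * w b2)).
Proof.
have [g gE gT] := tensor_form v w; have [h hE hT] := tensor_form u g.
transitivity (h (\sw_(a, b <- comul c) \sw_(a1, a2 <- comul a) a1 ⊗ (a2 ⊗ b))).
  rewrite raddf_tensor_sum; apply: eq_tensor_sum => a b /=.
  by rewrite raddf_tensor_sum; apply: eq_tensor_sum => a1 a2 /=; rewrite hT gT.
rewrite comulA raddf_tensor_sum; apply: eq_tensor_sum => a b /=.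
by rewrite hT gE mulr_tensor_sumr.
Qed.

Lemma counitl_form (F : fieldType) (C : coalgType F) (u : {scalar C}) (c : C) :
  \sw_(a, b <- comul c) (counit a * u b) = u c.
Proof.
rewrite -[in RHS](counitl c) raddf_tensor_sum; apply: eq_tensor_sum => a b /=.
by rewrite linearZ.
Qed.

Lemma counitr_form (F : fieldType) (C : coalgType F) (u : {scalar C}) (c : C) :
  \sw_(a, b <- comul c) (u a * counit b) = u c.
Proof.
rewrite -[in RHS](counitr c) raddf_tensor_sum; apply: eq_tensor_sum => a b /=.
by rewrite linearZ mulrC.
Qed.

(** The sum of e(c1) ε(c2) is e(c) by the right counit axiom, and ε(c) by applying ε to the
    hypothesis. *)
Lemma left_counit_unique (F : fieldType) (C : coalgType F) (e : {scalar C}) :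
  (forall c, \sw_(a, b <- comul c) e a *: b = c) -> e =1 counit.
Proof.
move=> eP c; rewrite -[in RHS](eP c) raddf_tensor_sum -counitr_form.
by apply: eq_tensor_sum => a b /=; rewrite linearZ.
Qed.

(** * Hopf pairings from the product axioms and nondegeneracy *)

Section PairingFromProducts.
Variables (F : fieldType) (H H' : hopfAlgType F).
Variable B : {bilinear H -> H' -> F | *%R & *%R}.
Hypothesis BmulrE : forall h h' k',
  B h (h' * k') = \sw_(h1, h2 <- comul h) (B h1 h' * B h2 k').
Hypothesis BmullE : forall h k h',
  \sw_(h1, h2 <- comul h') (B h h1 * B k h2) = B (h * k) h'.
Hypothesis Bnondegl : forall h, (forall h', B h h' = 0) -> h = 0.
Hypothesis Bnondegr : forall h', (forall h, B h h' = 0) -> h' = 0.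

(* By nondegeneracy, [B h (1 * k') = B h k'] says that [B _ 1] is a left counit. *)
Lemma pairing_1r_of_mul h : B h 1 = counit h.
Proof.
apply: (left_counit_unique (e := applyr B 1)) => c; apply/subr0_eq/Bnondegl => h'.
rewrite linearBl /= -[in X in _ - X](mul1r h') BmulrE.
rewrite -[B (tensor_sum _ _) _]/(applyr B h' _) raddf_tensor_sum /=.
by apply/eqP; rewrite subr_eq0; apply/eqP/eq_tensor_sum => a b /=; rewrite linearZl_LR.
Qed.

Lemma pairing_1l_of_mul h' : B 1 h' = counit h'.
Proof.
apply: (left_counit_unique (e := B 1)) => c; apply/subr0_eq/Bnondegr => h.
rewrite linearBr /= -[in X in _ - X](mul1r h) -BmullE raddf_tensor_sum /=.
by apply/eqP; rewrite subr_eq0; apply/eqP/eq_tensor_sum => a b /=; rewrite linearZr_LR.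
Qed.

(* Both sides are convolution inverses of [B]. *)
Lemma pairing_antipode_of_mul h h' : B h (antipode h') = B (antipode h) h'.
Proof.
pose S : {linear H -> H} := antipode; pose S' : {linear H' -> H'} := antipode.
(* The triple convolution of B(S·,·), B and B(·,S'·). Bracketed to the left, its first two factors
   collapse to counits and leave B(h, S'h'); bracketed to the right, its last two collapse and leave
   B(Sh, h'). *)
pose T a b c a' b' c' := B (S a) a' * (B b b' * B c (S' c')).
transitivity (\sw_(x, c <- comul h) \sw_(a, b <- comul x)
              \sw_(x', c' <- comul h') \sw_(a', b' <- comul x') T a b c a' b' c').
  rewrite -[LHS](counitl_form (applyr B (S' h'))); apply: eq_tensor_sum => x c /=.
  rewrite exchange_tensor_sum -[B c _](counitl_form (B c \o S')) mulr_tensor_sumr.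
  apply: eq_tensor_sum => x' c' /=.
  transitivity (\sw_(a, b <- comul x) (B (S a * b) x' * B c (S' c'))).
    rewrite -mulr_tensor_suml -[\sw_(a, b <- _) _](raddf_tensor_sum (applyr B x')).
    by rewrite antipodel /= linearZl_LR /= pairing_1l_of_mul mulrA.
  apply: eq_tensor_sum => a b; rewrite -BmullE mulr_tensor_suml.
  by apply: eq_tensor_sum => a' b'; rewrite /T mulrA.
transitivity (\sw_(a, y <- comul h) \sw_(b, c <- comul y)
              \sw_(a', y' <- comul h') \sw_(b', c' <- comul y') T a b c a' b' c').
  transitivity (\sw_(x, c <- comul h) \sw_(a, b <- comul x)
              \sw_(a', y' <- comul h') \sw_(b', c' <- comul y') T a b c a' b' c').
    apply: eq_tensor_sum => x c; apply: eq_tensor_sum => a b.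
    exact: (comulA_form (B (S a)) (B b) (B c \o S')).
  (* With [h'] rebracketed, its sums move outside so that coassociativity can be applied to [h] for
     fixed a', b', c'. *)
  rewrite exchange_tensor_sum2 [RHS]exchange_tensor_sum2.
  apply: eq_tensor_sum => a' y'; apply: eq_tensor_sum => b' c'.
  exact: (comulA_form (applyr B a' \o S) (applyr B b') (applyr B (S' c'))).
rewrite -[RHS](counitr_form (applyr B h' \o S)); apply: eq_tensor_sum => a y /=.
rewrite exchange_tensor_sum -[B (antipode a) _](counitr_form (B (S a))) mulr_tensor_suml.
apply: eq_tensor_sum => a' y'.
transitivity (\sw_(b', c' <- comul y') (B (S a) a' * B y (b' * S' c'))).
  rewrite exchange_tensor_sum; apply: eq_tensor_sum => b' c'.
  by rewrite BmulrE mulr_tensor_sumr.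
rewrite -mulr_tensor_sumr -[\sw_(b', c' <- _) _](raddf_tensor_sum (B y)).
by rewrite antipoder /= linearZr_LR /= pairing_1r_of_mul mulrA.
Qed.

Lemma nondegenerate_pairing_of_mul : nondegenerate_pairing B.
Proof.
split=> //; split=> // [h|h'|h h']; first exact: pairing_1r_of_mul.
  by rewrite pairing_1l_of_mul.
exact: pairing_antipode_of_mul.
Qed.

End PairingFromProducts.

(** * Bases from biorthogonality and spanning *)

Lemma collect_scaled_sum (F : fieldType) (V : lmodType F) (I : eqType)
    (b : I -> V) (t : seq (F * I)) :
  \sum_(p <- t) p.1 *: b p.2
  = \sum_(i <- undup (map snd t)) (\sum_(p <- t | p.2 == i) p.1) *: b i.
Proof.
under [RHS]eq_bigr do rewrite scaler_suml.
rewrite (exchange_big_dep predT) //=; apply: eq_big_seq => p pt.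
rewrite big_mkcond (bigD1_seq p.2) ?undup_uniq ?mem_undup ?map_f //= eqxx.
by rewrite big1 ?addr0 // => i; rewrite eq_sym => /negPf ->.
Qed.

(** Applying [xi n] to a combination isolates the coefficient at [n], times the nonzero [c n]. This
    gives independence, and, as every vector is a combination, also that the forms separate vectors;
    for a pairing, the latter is nondegeneracy on one side. *)
Lemma biorthogonal_basis (F : fieldType) (V : lmodType F) (I : eqType)
    (b : I -> V) (xi : I -> {scalar V}) (c : I -> F) :
  (forall n, c n != 0) -> (forall m n, xi n (b m) = c n * (m == n)%:R) ->
  (forall v, exists t : seq (F * I), v = \sum_(p <- t) p.1 *: b p.2) ->
  is_basis b /\ (forall v, (forall n, xi n v = 0) -> v = 0).
Proof.
move=> c0 xib bspan.
have coefE s a n : uniq s -> n \in s -> xi n (\sum_(i <- s) a i *: b i) = c n * a n.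
  move=> us ns; rewrite linear_sum (bigD1_seq n) //= linearZ xib eqxx mulr1 mulrC.
  by rewrite big1 ?addr0 // => i /negPf ni; rewrite linearZ xib ni /= !mulr0.
have coef0 s a : uniq s -> (forall n, xi n (\sum_(i <- s) a i *: b i) = 0) ->
    {in s, forall n, a n = 0}.
  move=> us x0 n ns; have /eqP := x0 n.
  by rewrite coefE // mulf_eq0 (negPf (c0 n)) => /eqP.
split; first split=> [s a us s0|v].
- by apply: coef0 => // n; rewrite s0 linear0.
(* A spanning list may repeat indices; collecting equal ones gives a duplicate-free list. *)
- by have [t ->] := bspan v; rewrite collect_scaled_sum; do 2 eexists.
move=> v; have [t ->] := bspan v; rewrite collect_scaled_sum => x0.
by apply: big1_seq => i /= it; rewrite (coef0 _ _ (undup_uniq _) x0) ?scale0r.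
Qed.

Lemma tens_span (F : fieldType) (V W U : lmodType F) (I J : eqType)
    (phi : {linear (V ⊗ W)%type -> U}) (b : I -> V) (d : J -> W) :
  bijective phi -> is_basis b -> is_basis d ->
  forall u, exists t : seq (F * (I * J)),
    u = \sum_(p <- t) p.1 *: phi (b p.2.1 ⊗ d p.2.2).
Proof.
move=> [phi' _ phiK] [_ bspan] [_ dspan] u; rewrite -[u]phiK.
elim/tensor_ind: (phi' u) => [|x y [s xE] [t yE]|v w].
- by exists [::]; rewrite linear0 big_nil.
- by exists (s ++ t); rewrite linearD xE yE big_cat.
have [s [a ->]] := bspan v; have [t [a' ->]] := dspan w.
exists [seq (a i * a' j, (i, j)) | i <- s, j <- t].
rewrite big_allpairs_dep linear_sumlz linear_sum; apply: eq_bigr => i _.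
rewrite linear_sumr linear_sum; apply: eq_bigr => j _ /=.
by rewrite linearZl_LR linearZr_LR /= !linearZ /= scalerA.
Qed.

(** * Product-coproduct duality for the two bicrossproducts *)

Section Bicrossproduct.
Variables (F : fieldType) (K L H Ks Ls Hs : hopfAlgType F).
Variables (act : {bilinear L -> K -> L}) (coact : {linear K -> (L ⊗ K)%type}).
Variable phi : {linear (K ⊗ L)%type -> H}.
Variable B1 : {bilinear K -> Ks -> F | *%R & *%R}.
Variable B2 : {bilinear L -> Ls -> F | *%R & *%R}.
Variables (lact : {bilinear Ls -> Ks -> Ks}) (rcoact : {linear Ls -> (Ls ⊗ Ks)%type}).
Variable psi : {linear (Ks ⊗ Ls)%type -> Hs}.
Variable B : {bilinear H -> Hs -> F | *%R & *%R}.
Hypothesis bicrossH : is_bicrossproduct act coact phi.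
Hypothesis pairB1 : hopf_pairing B1.
Hypothesis pairB2 : hopf_pairing B2.
Hypothesis dualHs : is_dual_bicrossproduct B1 B2 act coact lact rcoact psi.
Hypothesis BE : forall x y u v, B (phi (x ⊗ y)) (psi (u ⊗ v)) = B1 x u * B2 y v.

Lemma bicross_ind (P : H -> Prop) :
  P 0 -> (forall x y, P x -> P y -> P (x + y)) ->
  (forall k l, P (phi (k ⊗ l))) -> forall h, P h.
Proof.
move=> P0 PD Pt h; have [phi' _ phiK] := bicross_bij bicrossH.
rewrite -[h]phiK; elim/tensor_ind: (phi' h) => [|x y|//]; first by rewrite linear0.
by rewrite linearD; apply: PD.
Qed.

Lemma dual_bicross_ind (P : Hs -> Prop) :
  P 0 -> (forall x y, P x -> P y -> P (x + y)) ->
  (forall ka la, P (psi (ka ⊗ la))) -> forall h, P h.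
Proof.
move=> P0 PD Pt h; have [psi' _ psiK] := dual_bij dualHs.
rewrite -[h]psiK; elim/tensor_ind: (psi' h) => [|x y|//]; first by rewrite linear0.
by rewrite linearD; apply: PD.
Qed.

(** By linearity all three arguments may be pure tensors. The left action in the product of [Hs]
    then becomes, by [dual_actE], the coaction in the coproduct of [H]. *)
Lemma bicross_pairing_mulr h h' k' :
  B h (h' * k') = \sw_(h1, h2 <- comul h) (B h1 h' * B h2 k').
Proof.
elim/dual_bicross_ind: h' => [|x y IHx IHy|ka la].
- rewrite mul0r linear0r -[LHS](tensor_sum_const0 _ (comul h)).
  by apply: eq_tensor_sum => a b; rewrite linear0r mul0r.
- rewrite mulrDl linearDr IHx IHy -tensor_sum_split.
  by apply: eq_tensor_sum => a b; rewrite linearDr mulrDl.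
elim/dual_bicross_ind: k' => [|x y IHx IHy|ka' la'].
- rewrite mulr0 linear0r -[LHS](tensor_sum_const0 _ (comul h)).
  by apply: eq_tensor_sum => a b; rewrite linear0r mulr0.
- rewrite mulrDr linearDr IHx IHy -tensor_sum_split.
  by apply: eq_tensor_sum => a b; rewrite linearDr mulrDr.
(* [g] makes the right side visibly linear in [comul h], as the induction on [h] requires. *)
have [g gE gT] := tensor_form (applyr B (psi (ka ⊗ la))) (applyr B (psi (ka' ⊗ la'))).
rewrite -[RHS]gE; elim/bicross_ind: h => [|x y IHx IHy|k l].
- by rewrite linear0l !linear0.
- by rewrite linearDl !linearD IHx IHy.
(* The common expansion of both sides, with every product split and the action replaced by
   [coact]. *)
transitivity (\sw_(la1, la2 <- comul la) \sw_(k1, k2 <- comul k)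
    \sw_(x, y <- coact k2) \sw_(l1, l2 <- comul l)
    (B1 k1 ka * (B2 x la1 * B2 l1 la2) * (B1 y ka' * B2 l2 la'))).
  rewrite (dual_mul dualHs) raddf_tensor_sum; apply: eq_tensor_sum => la1 la2 /=.
  rewrite BE !pairing_mulr // mulr_tensor_suml; apply: eq_tensor_sum => k1 k2.
  rewrite (dual_actE dualHs) [B1 k1 ka * _]mulr_tensor_sumr mulr_tensor_suml.
  apply: eq_tensor_sum => x y; rewrite mulr_tensor_sumr.
  by apply: eq_tensor_sum => l1 l2; ring.
rewrite (bicross_comul bicrossH) exchange_tensor_sum raddf_tensor_sum.
apply: eq_tensor_sum => k1 k2 /=; rewrite exchange_tensor_sum raddf_tensor_sum.
apply: eq_tensor_sum => x y /=; rewrite exchange_tensor_sum raddf_tensor_sum.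
apply: eq_tensor_sum => l1 l2 /=; rewrite gT /= !BE -pairing_mull //.
by rewrite mulr_tensor_sumr mulr_tensor_suml.
Qed.

(** The mirror argument: [dual_coactE] turns the right action in the product of [H] into the
    coaction in the coproduct of [Hs]. *)
Lemma bicross_pairing_mull h k h' :
  \sw_(h1, h2 <- comul h') (B h h1 * B k h2) = B (h * k) h'.
Proof.
elim/bicross_ind: h => [|x y IHx IHy|k0 l0].
- rewrite mul0r linear0l -[RHS](tensor_sum_const0 _ (comul h')).
  by apply: eq_tensor_sum => a b; rewrite linear0l mul0r.
- rewrite mulrDl linearDl -IHx -IHy -tensor_sum_split.
  by apply: eq_tensor_sum => a b; rewrite linearDl mulrDl.
elim/bicross_ind: k => [|x y IHx IHy|k l].
- rewrite mulr0 linear0l -[RHS](tensor_sum_const0 _ (comul h')).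
  by apply: eq_tensor_sum => a b; rewrite linear0l mulr0.
- rewrite mulrDr linearDl -IHx -IHy -tensor_sum_split.
  by apply: eq_tensor_sum => a b; rewrite linearDl mulrDr.
have [g gE gT] := tensor_form (B (phi (k0 ⊗ l0))) (B (phi (k ⊗ l))).
rewrite -[LHS]gE; elim/dual_bicross_ind: h' => [|x y IHx IHy|ka la].
- by rewrite linear0r !linear0.
- by rewrite linearDr !linearD IHx IHy.
transitivity (\sw_(k1, k2 <- comul k) \sw_(ka1, ka2 <- comul ka)
    \sw_(la1, la2 <- comul la) \sw_(x, y <- rcoact la1)
    (B1 k0 ka1 * B2 l0 x * (B1 k1 ka2 * B1 k2 y * B2 l la2))).
  rewrite (dual_comul dualHs) [RHS]exchange_tensor_sum raddf_tensor_sum.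
  apply: eq_tensor_sum => ka1 ka2 /=; rewrite [RHS]exchange_tensor_sum raddf_tensor_sum.
  apply: eq_tensor_sum => la1 la2 /=; rewrite [RHS]exchange_tensor_sum raddf_tensor_sum.
  apply: eq_tensor_sum => x y /=; rewrite gT /= !BE pairing_mulr //.
  by rewrite mulr_tensor_suml mulr_tensor_sumr.
rewrite (bicross_mul bicrossH) -[RHS]/(applyr B (psi (ka ⊗ la)) _) raddf_tensor_sum.
apply: eq_tensor_sum => k1 k2 /=; rewrite BE -!pairing_mull // mulr_tensor_suml.
apply: eq_tensor_sum => ka1 ka2; rewrite mulr_tensor_sumr.
apply: eq_tensor_sum => la1 la2.
rewrite (dual_coactE dualHs) mulr_tensor_suml mulr_tensor_sumr.
by apply: eq_tensor_sum => x y; ring.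
Qed.

End Bicrossproduct.

(** * Dual bases of the bicrossproducts *)

Theorem corollary2p1 (R : realType) (f : ground_field)
    (F := base_field R f)
    (K L H Ks Ls Hs : hopfAlgType F)
    (act : {bilinear L -> K -> L}) (coact : {linear K -> (L ⊗ K)%type})
    (phi : {linear (K ⊗ L)%type -> H})
    (B1 : {bilinear K -> Ks -> F | *%R & *%R})
    (B2 : {bilinear L -> Ls -> F | *%R & *%R})
    (lact : {bilinear Ls -> Ks -> Ks}) (rcoact : {linear Ls -> (Ls ⊗ Ks)%type})
    (psi : {linear (Ks ⊗ Ls)%type -> Hs})
    (B : {bilinear H -> Hs -> F | *%R & *%R})
    (I J : eqType)
    (k : I -> K) (ka : I -> Ks) (l : J -> L) (la : J -> Ls) :
  is_bicrossproduct act coact phi ->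
  nondegenerate_pairing B1 ->
  nondegenerate_pairing B2 ->
  is_dual_bicrossproduct B1 B2 act coact lact rcoact psi ->
  (forall x y u v, B (phi (x ⊗ y)) (psi (u ⊗ v)) = B1 x u * B2 y v) ->
  (dual_bases B1 k ka -> dual_bases B2 l la ->
   dual_bases B (fun p : I * J => phi (k p.1 ⊗ l p.2))
                (fun p : I * J => psi (ka p.1 ⊗ la p.2)))
  /\
  ((forall m m', B1 (k m) (ka m') = (m == m')%:R) ->
   (forall n n', B2 (l n) (la n') = (n == n')%:R) ->
   forall m n m' n',
     B (phi (k m ⊗ l n)) (psi (ka m' ⊗ la n')) = (m == m')%:R * (n == n')%:R).
Proof.
move=> bicrossH [pairB1 _ _] [pairB2 _ _] dualHs BE; split; last first.
  by move=> B1E B2E m n m' n'; rewrite BE B1E B2E.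
case=> _ kb kab [c [c0 cE]] [_ lb lab [d [d0 dE]]].
pose e (p : I * J) := c p.1 * d p.2.
have e0 p : e p != 0 by rewrite mulf_neq0.
have eE p q : B (phi (k p.1 ⊗ l p.2)) (psi (ka q.1 ⊗ la q.2)) = e q * (p == q)%:R.
  rewrite BE cE dE /e; case: p q => [m n] [m' n'] /=; rewrite xpair_eqE.
  by case: (m == m'); case: (n == n'); rewrite ?mulr0 ?mul0r ?mulr1.
have [bH ndl] := biorthogonal_basis (xi := fun q => applyr B (psi (ka q.1 ⊗ la q.2)))
  e0 eE (tens_span (bicross_bij bicrossH) kb lb).
(* The scalar must carry the index of the functional, now on the [H] side; it may be moved because
   the delta vanishes off the diagonal. *)
have eE' p q : B (phi (k q.1 ⊗ l q.2)) (psi (ka p.1 ⊗ la p.2)) = e q * (p == q)%:R.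
  by rewrite eE eq_sym; case: eqVneq => [->|_]; rewrite ?mulr0.
have [bHs ndr] := biorthogonal_basis (xi := fun q => B (phi (k q.1 ⊗ l q.2)))
  e0 eE' (tens_span (dual_bij dualHs) kab lab).
split=> //; last by exists e.
apply: nondegenerate_pairing_of_mul => [h h' k'|h k' h'|h hB|h' hB].
- exact: (bicross_pairing_mulr bicrossH pairB1 pairB2 dualHs BE).
- exact: (bicross_pairing_mull bicrossH pairB1 pairB2 dualHs BE).
- by apply: ndl => q; apply: hB.
- by apply: ndr => q; apply: hB.
Qed.
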